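(* Let $B$ be a basis, $E_B=A_B^{-1}D_B$, and let $E_B=QUQ^H$ be its Schur decomposition ($Q$ a unitary matrix, $Q^H$ its conjugate transpose, $U$ an upper triangular matrix). Then, for any $\lambda$ such that $I+\lambda E_B$ is invertible, $$x_B(\lambda) = Q(I+\lambda U)^{-1}Q^{H}x_B(0).$$
   Context: Let $A, D \in \mathbb{R}^{m\times n}$, $b\in\mathbb{R}^m$, $c\in\mathbb{R}^n$, and for $\lambda\in\mathbb{R}$ let $\mathcal{P}(\lambda)$ be the linear program $\min\{c^T x : Ax+\lambda Dx=b,\ x\ge 0\}$. A basis $B$ is a choice of $m$ column indices such that $A_B$ is invertible; $M_B$ denotes the submatrix of a matrix $M$ formed by the columns indexed by $B$. Whenever $A_B+\lambda D_B$ is invertible (equivalently $I+\lambda E_B$ is invertible), $x_B(\lambda) = (A_B+\lambda D_B)^{-1}b$; in particular $x_B(0)=A_B^{-1}b$. The Schur decomposition is over $\mathbb{C}$; $I$ is the $m\times m$ identity. *)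

(* Defs.v *)
From mathcomp Require Import all_boot all_order all_algebra.
From mathcomp Require Export spectral sesquilinear.
From mathcomp.real_closed Require Export complex.
From mathcomp Require Export reals.

Set Implicit Arguments.
Unset Strict Implicit.
Unset Printing Implicit Defensive.

Import Order.TTheory GRing.Theory Num.Theory.
Local Open Scope ring_scope.
Local Open Scope complex_scope.
Local Open Scope sesquilinear_scope.

(* A choice of m column indices is a function B : 'I_m -> 'I_n listing them,
   and M_B is [colsub B M].  The indices need not be required to be distinct:
   this follows from the invertibility of A_B. *)
Definition is_basis (R : realType) (m n : nat) (A : 'M[R]_(m, n))
    (B : 'I_m -> 'I_n) : Prop :=
  colsub B A \in unitmx.

Definition E_of (R : realType) (m n : nat) (A D : 'M[R]_(m, n))
    (B : 'I_m -> 'I_n) : 'M[R]_m :=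
  invmx (colsub B A) *m colsub B D.

(* Meaningful only when A_B + lambda D_B is invertible ([invmx] is total). *)
Definition x_of (R : realType) (m n : nat) (A D : 'M[R]_(m, n)) (b : 'cV[R]_m)
    (B : 'I_m -> 'I_n) (lambda : R) : 'cV[R]_m :=
  invmx (colsub B A + lambda *: colsub B D) *m b.

Definition to_C (R : realType) (p q : nat) (M : 'M[R]_(p, q)) : 'M[R[i]]_(p, q) :=
  map_mx (real_complex R) M.

(* [is_trig_mx] means lower triangular, hence the transpose on U. *)
Definition is_schur_decomposition (R : realType) (m : nat)
    (E Q U : 'M[R[i]]_m) : Prop :=
  [/\ Q \is unitarymx, is_trig_mx U^T & E = Q *m U *m Q ^t*].

(* Main.v *)
Require Import Defs.
From mathcomp Require Import all_boot all_order all_algebra.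

(** Factoring [A_B] out of [A_B + lambda D_B = A_B (I + lambda E_B)] gives
    [x_B(lambda) = (I + lambda E_B)^-1 x_B(0)] ([x_of_eq_resolvent]), so that
    [lambda] enters only through the inverse of [I + lambda E_B].  Over the
    complex numbers, [Q^H] is the inverse of [Q], so the Schur decomposition
    is in particular a similarity between [E_B] and [U], and similarity
    commutes with [X |-> (I + lambda X)^-1] ([unitmx_1Dscale_conj],
    [invmx_1Dscale_conj]).  Conjugating turns the inverse of [I + lambda E_B]
    into [Q (I + lambda U)^-1 Q^H], and transfers its invertibility to
    [I + lambda U].  Since taking inverses commutes with the embedding of the
    reals in the complex numbers, the real identity can be read there. *)

Import GRing.Theory.

Local Open Scope ring_scope.
Local Open Scope complex_scope.
Local Open Scope sesquilinear_scope.

Lemma invmx_mul (K : comUnitRingType) (m : nat) (M N : 'M[K]_m) :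
  M \in unitmx -> N \in unitmx ->
  invmx (M *m N) = invmx N *m invmx M.
Proof.
move=> Mu Nu.
have MNu : M *m N \in unitmx by rewrite unitmx_mul Mu Nu.
by rewrite -[RHS](mulKmx MNu) [M *m N *m (_ *m _)]mulmxA mulmxK // mulmxV // mulmx1.
Qed.

(** The identity matrix is its own conjugate, since it equals [P P'], so the
    conjugation by [P] factors out of the whole sum. *)
Lemma conj_1Dscale (K : comUnitRingType) (m : nat) (P P' U : 'M[K]_m) (l : K) :
  P *m P' = 1%:M ->
  1%:M + l *: (P *m U *m P') = P *m (1%:M + l *: U) *m P'.
Proof. by move=> PP'; rewrite mulmxDr mulmxDl mulmx1 PP' -scalemxAr -scalemxAl. Qed.

(** For square matrices the one-sided identity [P P' = 1] already makes both
    [P] and [P'] invertible, so they can be cancelled around [1 + l U]. *)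
Lemma unitmx_1Dscale_conj (K : comUnitRingType) (m : nat)
    (P P' U : 'M[K]_m) (l : K) :
  P *m P' = 1%:M ->
  (1%:M + l *: (P *m U *m P') \in unitmx) = (1%:M + l *: U \in unitmx).
Proof.
move=> PP'; have [Pu P'u] := mulmx1_unit PP'.
by rewrite conj_1Dscale // !unitmx_mul Pu P'u andbT.
Qed.

Lemma invmx_1Dscale_conj (K : comUnitRingType) (m : nat)
    (P P' U : 'M[K]_m) (l : K) :
  P *m P' = 1%:M -> 1%:M + l *: U \in unitmx ->
  invmx (1%:M + l *: (P *m U *m P')) = P *m invmx (1%:M + l *: U) *m P'.
Proof.
move=> PP' Vu; have [Pu P'u] := mulmx1_unit PP'.
have PVu : P *m (1%:M + l *: U) \in unitmx by rewrite unitmx_mul Pu.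
have invP : invmx P = P' by rewrite -[invmx P]mulmx1 -PP' mulKmx.
have invP' : invmx P' = P by rewrite -[invmx P']mul1mx -PP' mulmxK.
by rewrite conj_1Dscale // !invmx_mul // invP invP' mulmxA.
Qed.

(** By [A_B + lambda D_B = A_B (I + lambda E_B)], the factor [A_B^-1 b] that
    remains on the right is the value at [lambda = 0]. *)
Lemma x_of_eq_resolvent (R : realType) (m n : nat) (A D : 'M[R]_(m, n))
    (b : 'cV[R]_m) (B : 'I_m -> 'I_n) (lambda : R) :
  is_basis A B -> 1%:M + lambda *: E_of A D B \in unitmx ->
  x_of A D b B lambda
    = invmx (1%:M + lambda *: E_of A D B) *m x_of A D b B 0.
Proof.
rewrite /is_basis /x_of => Au Eu; rewrite scale0r addr0.
have -> : colsub B A + lambda *: colsub B D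
    = colsub B A *m (1%:M + lambda *: E_of A D B).
  by rewrite mulmxDr mulmx1 -scalemxAr /E_of mulKVmx.
by rewrite invmx_mul // mulmxA.
Qed.

Theorem theorem3 (R : realType) (m n : nat) (A D : 'M[R]_(m, n)) (b : 'cV[R]_m)
    (B : 'I_m -> 'I_n) (Q U : 'M[R[i]]_m) (lambda : R) :
  is_basis A B ->
  is_schur_decomposition (to_C (E_of A D B)) Q U ->
  1%:M + lambda *: E_of A D B \in unitmx ->
  1%:M + lambda%:C *: U \in unitmx /\
  to_C (x_of A D b B lambda)
    = Q *m invmx (1%:M + lambda%:C *: U) *m Q ^t* *m to_C (x_of A D b B 0).
Proof.
move=> Au [/unitarymxP QQ _ EQ] Eu.
have CE : to_C (1%:M + lambda *: E_of A D B)
    = 1%:M + lambda%:C *: (Q *m U *m Q ^t*).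
  by rewrite -EQ /to_C map_mxD map_mx1 map_mxZ.
have Vu : 1%:M + lambda%:C *: U \in unitmx.
  by rewrite -(@unitmx_1Dscale_conj _ _ _ _ _ _ QQ) -CE map_unitmx.
split=> //.
rewrite (@x_of_eq_resolvent R) // {1}/to_C map_mxM map_invmx -!/(to_C _) CE.
by rewrite invmx_1Dscale_conj.
Qed.
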